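(* Let $(x(n))_{n\in\mathbb{N}}$ be a uniformly bounded sequence in $\mathbb{C}$. Then the difference sequence $(x(n+1)-x(n))_{n\in\mathbb{N}}$ has zero entropy if and only if $(x(n))_{n\in\mathbb{N}}$ has zero entropy.
   Context: $\mathbb{N}=\{0,1,2,\dots\}$. Entropy of a sequence: let $x=(x(n))_{n\in\mathbb{N}}$ be a sequence in $K=\mathbb{R}/\mathbb{Z}$, or a bounded sequence in $K=\mathbb{C}$. Let $X_0$ be the closure of $\{x(n):n\in\mathbb{N}\}$ in $K$ (a compact space), and let $X_x$ be the closure of $\{(x(m),x(m+1),x(m+2),\dots): m\in\mathbb{N}\}$ in $X_0^{\mathbb{N}}$ with the product topology. The shift $\sigma:(\omega_0,\omega_1,\dots)\mapsto(\omega_1,\omega_2,\dots)$ maps $X_x$ continuously to itself. The (anqie) entropy of $x$, denoted $\mathrm{AE}(x)\in[0,\infty]$, is the topological entropy of $(X_x,\sigma)$: the supremum over open covers $\mathcal{U}$ of $X_x$ of $\lim_{n}\frac1n\log\mathcal{N}(\mathcal{U}\vee\sigma^{-1}\mathcal{U}\vee\cdots\vee\sigma^{-n+1}\mathcal{U})$, where $\mathcal{N}(\mathcal{W})$ is the minimal cardinality of a subcover of $\mathcal{W}$. *)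

(* Defs.v *)
From HB Require Import structures.
From mathcomp Require Import all_boot all_order all_algebra.
From mathcomp Require Import all_classical all_reals all_analysis.
From mathcomp Require Export complex.

Set Implicit Arguments.
Unset Strict Implicit.
Unset Printing Implicit Defensive.

Import Order.TTheory GRing.Theory Num.Theory.
Import numFieldTopology.Exports numFieldNormedType.Exports.

Local Open Scope classical_set_scope.
Local Open Scope ring_scope.

Section TopologicalEntropy.
Context (R : realType) (T : topologicalType).
Implicit Types (U V W : set (set T)) (f : T -> T).

Definition is_cover U := \bigcup_(A in U) A = [set: T].

Definition is_open_cover U := (forall A, U A -> open A) /\ is_cover U.

Definition cover_join U V : set (set T) := [set A `&` B | A in U & B in V].

Definition cover_preimage f U : set (set T) := [set f @^-1` A | A in U].

(* The neutral element is the one-block cover, so that the value at n >= 1 is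
   U \/ f^-1 U \/ ... \/ f^-(n-1) U. *)
Definition iterated_join f U (n : nat) : set (set T) :=
  \big[cover_join/[set [set: T]]]_(i < n) cover_preimage (iter i f) U.

(* Equal to +oo when W has no finite subcover. *)
Definition min_subcover W : \bar R :=
  ereal_inf [set (k%:R)%:E | k in
    [set k : nat | exists V, [/\ V `<=` W, is_cover V & (V #= `I_k)%card]]].

(* For compact nonempty T and continuous f the limit exists by subadditivity. *)
Definition cover_entropy f U : \bar R :=
  lim ((n%:R^-1)%:E * lne (min_subcover (iterated_join f U n)) @[n --> \oo])%E.

Definition topological_entropy f : \bar R :=
  ereal_sup [set cover_entropy f U | U in is_open_cover].

End TopologicalEntropy.

Section ShiftSystem.
Context (K : topologicalType).

Definition seq_shift (w : {ptws nat -> K}) : {ptws nat -> K} :=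
  fun n => w n.+1.

Definition seq_tail (w : {ptws nat -> K}) (m : nat) : {ptws nat -> K} :=
  fun n => w (m + n)%N.

Definition orbit_closure (w : {ptws nat -> K}) : set {ptws nat -> K} :=
  closure (range (seq_tail w)).

Lemma seq_shift_continuous : continuous seq_shift.
Proof.
move=> w.
have FF : Filter (seq_shift v @[v --> w]) by apply: fmap_filter; apply: nbhs_filter.
apply/cvg_sup => n U [_ [[A oA <-] Aw] AU].
apply: filterS AU _; apply: (@proj_continuous nat (fun=> K) n.+1 w).
exact: open_nbhs_nbhs.
Qed.

Lemma orbit_closure_shift (w v : {ptws nat -> K}) :
  orbit_closure w v -> orbit_closure w (seq_shift v).
Proof.
move=> wv B /seq_shift_continuous /wv [_ [[m _ <-] Bm]].
exists (seq_tail w m.+1); split; first by exists m.+1.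
have -> // : seq_tail w m.+1 = seq_shift (seq_tail w m).
by apply/funext => n; rewrite /seq_tail /seq_shift addnS addSn.
Qed.

Definition orbit_shift (w : {ptws nat -> K}) (v : orbit_closure w) :
    orbit_closure w :=
  SigSub (mem_set (orbit_closure_shift (set_valP v))).

Lemma mem_closure_range (x : nat -> K) n : x n \in closure (range x).
Proof. by apply/mem_set/subset_closure; exists n. Qed.

(* x as a point of X_0^nat, where X_0 is the closure of its range. *)
Definition closure_seq (x : nat -> K) : {ptws nat -> closure (range x)} :=
  fun n => SigSub (mem_closure_range x n).

End ShiftSystem.

Definition anqie_entropy (R : realType) (K : topologicalType) (x : nat -> K) :
    \bar R :=
  topological_entropy R (@orbit_shift _ (closure_seq x)).

(* Main.v *)
Require Import Defs.
From mathcomp Require Import all_boot all_order all_algebra.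
From mathcomp Require Import all_classical all_reals all_analysis.
From mathcomp Require Import complex.
From mathcomp Require Import finmap lra.
Import Order.TTheory GRing.Theory Num.Theory.
Import numFieldTopology.Exports numFieldNormedType.Exports.
Local Open Scope ring_scope.
Local Open Scope complex_scope.

(* A bounded sequence has zero entropy iff, at every scale e, the number of
   e-balls (sup metric) needed to cover its blocks of length n grows
   subexponentially in n: one direction uses the Lebesgue number of an open
   cover, the other the cover by preimages of e-balls, for which Fekete's lemma
   guarantees that the limit defining the entropy exists.

   In this form, blocks of length n + 1 of x determine blocks of length n of
   its difference sequence at a comparable scale.  Conversely, a block of the
   difference sequence and the values of x every L steps determine a block of x;
   the latter values cost at most a factor C(e) ^ (n / L + 1), of arbitrarily
   small exponential rate as L grows. *)

(** * Fekete's lemma for nonnegative subadditive sequences *)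

Section Fekete.
Local Open Scope classical_set_scope.
Context (R : realType) (a : nat -> R).
Hypothesis a_ge0 : forall n, 0 <= a n.
Hypothesis aD : forall m n, a (m + n)%N <= a m + a n.

Lemma subadditive_muln_le q n : a (q * n)%N <= q%:R * a n + a 0.
Proof.
elim: q => [|q IH]; first by rewrite mul0n mul0r add0r.
rewrite mulSn (le_trans (aD _ _))// -natr1 mulrDl mul1r; lra.
Qed.

(** Division of [n] by [p] with remainder: the sum over all residues bounds the remainder's term
    uniformly in [n], and [a 0], not assumed to vanish, pays for an empty quotient. *)
Lemma subadditive_divn_le p n : (0 < p)%N ->
  a n <= n%:R * (p%:R^-1 * a p) + (a 0 + \sum_(r < p) a r).
Proof.
move=> p0; have pR0 : 0 < p%:R :> R by rewrite ltr0n.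
rewrite {1}(divn_eq n p) (le_trans (aD _ _))// addrA lerD//.
  rewrite (le_trans (subadditive_muln_le _ _))// lerD2r mulrA.
  by rewrite ler_wpM2r// ler_pdivlMr// -natrM ler_nat leq_divM.
by rewrite (bigD1 (Ordinal (ltn_pmod n p0)))//= lerDl sumr_ge0.
Qed.

(** The limit is the infimum of the averages over [n > 0]: a [p] whose average is almost minimal
    controls all large [n]. *)
Lemma fekete : cvgn (fun n => n%:R^-1 * a n).
Proof.
pose S := [set n%:R^-1 * a n | n in [set n | (0 < n)%N]].
have S0 : lbound S 0.
  by move=> _ [n _ <-]; rewrite mulr_ge0// invr_ge0 ler0n.
have Si : has_inf S by split; [exists (1^-1 * a 1), 1%N | exists 0].
apply/cvg_ex; exists (inf S); apply/cvgrPdist_le => e e0.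
have e20 : 0 < e / 2 by rewrite divr_gt0.
have [_ [p p0 <-] pS] := inf_adherent e20 Si.
pose C := a 0 + \sum_(r < p) a r.
have C0 : 0 <= C by rewrite addr_ge0// sumr_ge0.
(* Past this threshold the additive constant [C] is at most [n * (e / 2)]; the other half of [e] is
   the slack in the choice of [p]. *)
exists (Num.truncn (C / (e / 2))).+1 => // n /= nC.
have n0 : (0 < n)%N by apply: leq_trans nC.
have nR0 : 0 < n%:R :> R by rewrite ltr0n.
have Sn : inf S <= n%:R^-1 * a n.
  by apply: ge_inf; [exists 0 | exists n].
rewrite distrC ger0_norm ?subr_ge0// lerBlDl.
rewrite -(ler_pM2l nR0) mulrA divff ?gt_eqF// mul1r.
rewrite (le_trans (subadditive_divn_le p n p0))//.
have CN : C <= n%:R * (e / 2).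
  rewrite mulrC -ler_pdivrMl// mulrC (le_trans (ltW (truncnS_gt _)))//.
  by rewrite ler_nat.
have -> : n%:R * (inf S + e) = n%:R * (inf S + e / 2) + n%:R * (e / 2).
  by rewrite -mulrDr -addrA -splitr.
by rewrite lerD// ler_wpM2l// ltW.
Qed.

End Fekete.

(** * Block growth of a sequence and of its differences *)

Section BlockComplexity.
Context (R : realType) (F : numFieldType) (V : normedModType F).
Implicit Types (x : nat -> V) (e : F) (n : nat).

(** The centres [c j] need not be blocks of [x], so differences and partial sums of centres can
    serve as new centres. *)
Definition block_net x e n (J : finType) (c : J -> nat -> V) : Prop :=
  forall m, exists j, forall i, (i < n)%N -> `|x (m + i)%N - c j i| < e.

Definition subexponential_blocks x : Prop :=
  forall e (eta : R), 0 < e -> 0 < eta -> exists N, forall n, (N <= n)%N ->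
  exists (J : finType) (c : J -> nat -> V),
    block_net x e n J c /\ ln #|J|%:R <= eta * n%:R.

Lemma subexponential_blocks_diff x :
  subexponential_blocks x ->
  subexponential_blocks (fun n => x n.+1 - x n).
Proof.
move=> xP e eta e0 eta0.
have [e20 eta20] : 0 < e / 2 /\ 0 < eta / 2 by rewrite !divr_gt0.
(* The successor forces [n >= 1], hence [eta / 2 * (n + 1) <= eta * n]. *)
have [N NP] := xP _ _ e20 eta20; exists N.+1 => n Nn.
have [J [c [cP Jn]]] := NP n.+1 (leqW (ltnW Nn)).
exists J, (fun j i => c j i.+1 - c j i); split; last first.
  have n1 : 1 <= n%:R :> R by rewrite ler1n (leq_trans _ Nn).
  rewrite (le_trans Jn)// -(natr1 n).
  have := ler_wpM2l (ltW eta20) n1; lra.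
move=> m; have [j jP] := cP m; exists j => i ni.
rewrite (splitr e) -addnS opprD addrACA -opprD.
by rewrite (le_lt_trans (ler_normB _ _))// ltrD// jP// leqW.
Qed.

Lemma block_telescope x m p i : (p <= i)%N ->
  x (m + i)%N = x (m + p)%N + \sum_(p <= t < i) (x (m + t).+1 - x (m + t)%N).
Proof.
move=> pi; rewrite (eq_big_nat _ _ (F2 := fun t => x (m + t.+1)%N - x (m + t)%N)).
  by rewrite (telescope_sumr (fun t => x (m + t)%N))// addrC subrK.
by move=> t _; rewrite addnS.
Qed.

(* The differences are taken at scale e / (2 L), so that the error accumulated
   between two consecutive multiples of L stays below e / 2. *)
Lemma subexponential_blocks_of_diff x :
  (forall e, 0 < e ->
    exists (J : finType) (c : J -> nat -> V), block_net x e 1 J c) ->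
  subexponential_blocks (fun n => x n.+1 - x n) ->
  subexponential_blocks x.
Proof.
move=> xtb dP e eta e0 eta0.
have e20 : 0 < e / 2 by rewrite divr_gt0.
have eta30 : 0 < eta / 3 by rewrite divr_gt0.
have [J1 [c1 c1P]] := xtb _ e20.
(* [L] is so large that one sampled value every [L] steps costs at most [eta / 3] per step. *)
pose L := (Num.truncn (ln (#|J1|%:R : R) / (eta / 3))).+1.
have LP : ln #|J1|%:R <= eta / 3 * L%:R :> R.
  by rewrite mulrC -ler_pdivrMr// ltW// truncnS_gt.
have LF0 : 0 < L%:R :> F by rewrite ltr0n.
have eL0 : 0 < e / 2 / L%:R by rewrite divr_gt0.
have [N NP] := dP _ _ eL0 eta30.
exists (maxn N L) => n; rewrite geq_max => /andP[Nn Ln].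
have [J0 [c0 [c0P J0n]]] := NP n Nn.
pose Q := (n %/ L)%N.
(* The centre at [i] is the sampled value at the last multiple of [L] up to [i], plus the
   approximate differences from there to [i]. *)
exists (J0 * {ffun 'I_Q.+1 -> J1})%type, (fun (js : J0 * {ffun 'I_Q.+1 -> J1}) i =>
  c1 (js.2 (inord (i %/ L))) 0%N + \sum_((i %/ L) * L <= t < i) c0 js.1 t).
split.
  move=> m; have [j jP] := c0P m.
  have /choice[s sP] : forall q : 'I_Q.+1, exists j1,
      `|x (m + q * L)%N - c1 j1 0%N| < e / 2.
    by move=> q; have [j1 j1P] := c1P (m + q * L)%N; exists j1;
      rewrite -[X in x X]addn0 j1P.
  exists (j, [ffun q => s q]) => i ni /=.
  rewrite ffunE; set q := (i %/ L)%N.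
  have qi : (q * L <= i)%N by rewrite leq_divM.
  have qQ : (q < Q.+1)%N by rewrite ltnS leq_div2r// ltnW.
  rewrite (block_telescope _ _ _ _ qi) opprD addrACA -sumrB.
  rewrite (le_lt_trans (ler_normD _ _))// (splitr e) ltr_leD//.
    by have := sP (inord q); rewrite inordK.
  rewrite (le_trans (ler_norm_sum _ _ _))//.
  have -> : e / 2 = \sum_(t < L) (e / 2 / L%:R).
    by rewrite sumr_const card_ord -[RHS]mulr_natr divfK// gt_eqF.
  rewrite (@le_trans _ _ (\sum_(q * L <= t < i) (e / 2 / L%:R)))//.
    by apply: ler_sum_nat => t /andP[_ ti]; rewrite ltW// jP// (ltn_trans ti).
  rewrite sumr_const_nat sumr_const card_ord ler_wpMn2l ?(ltW eL0)//.
  by rewrite leq_subLR {1}(divn_eq i L) leq_add2l ltnW// ltn_mod.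
have [j0 _] := c0P 0%N; have [j1 _] := c1P 0%N.
have J0_gt0 : (0 < #|J0|)%N by apply/card_gt0P; exists j0.
have J1_gt0 : (0 < #|J1|)%N by apply/card_gt0P; exists j1.
rewrite card_prod card_ffun card_ord natrM natrX lnM ?posrE ?exprn_gt0 ?ltr0n//.
rewrite lnXn ?ltr0n// -[_ *+ Q.+1]mulr_natl.
(* Since [L <= n], the [Q + 1] samples span at most [2 n] steps; they use two thirds of [eta] and
   the differences the last third. *)
have Qn : Q.+1%:R * ln #|J1|%:R <= eta / 3 * (n%:R + n%:R) :> R.
  rewrite (le_trans (ler_wpM2l (ler0n _ _) LP))// mulrCA ler_wpM2l ?(ltW eta30)//.
  by rewrite -natrM -natrD ler_nat mulSn leq_add// leq_divM.
lra.
Qed.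

End BlockComplexity.

(** * Subcovers of iterated joins as families of itineraries *)

Section Itineraries.
Local Open Scope classical_set_scope.
Context (T : topologicalType) (f : T -> T) (U : set (set T)).
Implicit Types (n : nat) (J : finType).

(** A finite subcover of the [n]-fold join, each member recorded by its factors. Repetitions among
    the indices are allowed, so products of index types can be formed freely. *)
Definition itinerary_cover n J : Prop := exists A : J -> nat -> set T,
  (forall j i, (i < n)%N -> U (A j i)) /\
  forall v, exists j, forall i, (i < n)%N -> A j i (iter i f v).

Lemma big_cover_joinP (W : nat -> set (set T)) n (B : set T) :
  (\big[@cover_join T/[set [set: T]]]_(i < n) W i) B <->
  exists A : nat -> set T, (forall i, (i < n)%N -> W i (A i)) /\
    B = [set v | forall i, (i < n)%N -> A i v].
Proof.
elim: n W B => [|n IH] W B.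
  rewrite big_ord0; split=> [->|[A [_ ->]]].
    by exists (fun=> setT); split=> //; apply/seteqP; split.
  by apply/seteqP; split.
rewrite big_ord_recl; split=> [[A0 WA0 [B' /(IH (fun i => W i.+1))]]|].
  move=> [A [WA ->] <-].
  exists (fun i => if i is i'.+1 then A i' else A0); split.
    by case=> [|i] //; apply: WA.
  apply/seteqP; split=> v /= => [[A0v Av] [|i] // ni|Av]; first exact: Av.
  by split=> [|i ni]; [exact: (Av 0%N) | exact: (Av i.+1)].
move=> [A [WA ->]]; exists (A 0%N); first exact: WA.
exists [set v | forall i, (i < n)%N -> A i.+1 v].
  apply/(IH (fun i => W i.+1)); exists (fun i => A i.+1).
  by split=> // i ni; apply: WA.
apply/seteqP; split=> v /= => [[A0v Av] [|i] // ni|Av]; first exact: Av.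
by split=> [|i ni]; apply: Av.
Qed.

Lemma iterated_joinP n (B : set T) :
  iterated_join f U n B <->
  exists A : nat -> set T, (forall i, (i < n)%N -> U (A i)) /\
    B = [set v | forall i, (i < n)%N -> A i (iter i f v)].
Proof.
rewrite /iterated_join.
rewrite (big_cover_joinP (fun i => cover_preimage (iter i f) U)).
split=> [[A [UA ->]]|[A [UA ->]]].
  have /choice[A' A'P] : forall i, exists Ai, (i < n)%N ->
      U Ai /\ A i = iter i f @^-1` Ai.
    move=> i; have [ni|ni] := ltnP i n; last by exists setT.
    by have [Ai UAi Ai_eq] := UA _ ni; exists Ai.
  exists A'; split=> [i /A'P[]//|].
  apply/seteqP; split=> v /= Av i ni; have := Av i ni;
    by have [_ ->] := A'P _ ni.
by exists (fun i => iter i f @^-1` A i); split=> // i /UA; exists (A i).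
Qed.

(** An itinerary of [v] for [m] steps is continued by one of [iter m f v]; this is the source of
    subadditivity. *)
Lemma itinerary_coverD m n J J' :
  itinerary_cover m J -> itinerary_cover n J' ->
  itinerary_cover (m + n) (J * J')%type.
Proof.
move=> [A [UA Ac]] [A' [UA' A'c]].
exists (fun j i => if (i < m)%N then A j.1 i else A' j.2 (i - m)%N); split.
  move=> j i ni; case: ltnP => mi; first exact: UA.
  by apply: UA'; rewrite ltn_subLR.
move=> v; have [j jP] := Ac v; have [j' j'P] := A'c (iter m f v).
exists (j, j') => i ni /=; case: ltnP => mi; first exact: jP.
by have := j'P (i - m)%N; rewrite -iterD subnK// ltn_subLR//; apply.
Qed.

Lemma itinerary_cover0 : itinerary_cover 0 unit.
Proof. by exists (fun _ _ => setT); split=> // v; exists tt. Qed.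

Lemma itinerary_cover_exists n J :
  itinerary_cover 1 J -> exists J', itinerary_cover n J'.
Proof.
move=> J1; elim: n => [|n [J' J'n]]; first by exists unit; apply: itinerary_cover0.
by exists (J * J')%type; rewrite -add1n; apply: itinerary_coverD.
Qed.

Lemma itinerary_coverW m n J : (m <= n)%N ->
  itinerary_cover n J -> itinerary_cover m J.
Proof.
move=> mn [A [UA Ac]]; exists A; split=> [j i im|v].
  by apply: UA; apply: leq_trans im mn.
by have [j jP] := Ac v; exists j => i im; apply: jP; apply: leq_trans im mn.
Qed.

Context (R : realType).

Lemma min_subcover_le n J : itinerary_cover n J ->
  (min_subcover R (iterated_join f U n) <= (#|J|%:R)%:E)%E.
Proof.
move=> [A [UA Ac]].
pose B j := [set v | forall i, (i < n)%N -> A j i (iter i f v)].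
have VJ : (B @` [set: J] #<= `I_#|J|)%card.
  rewrite (card_le_trans (card_image_le _ _))//.
  rewrite (_ : [set: J] = enum_val @` [set: 'I_#|J|]).
    by rewrite (card_le_trans (card_image_le _ _))// (card_le_eqr card_II).
  by apply/seteqP; split=> // j _; exists (enum_rank j); rewrite // enum_rankK.
(* Distinct indices may give the same set, so the exact cardinality [k] demanded by [min_subcover]
   can be smaller than that of [J]. *)
have /finite_setP[k Vk] : finite_set (B @` [set: J]) by apply: finite_image.
apply: (@le_trans _ _ (k%:R)%:E); last first.
  rewrite lee_fin ler_nat -card_le_II.
  by rewrite -(card_le_eql Vk).
apply: ereal_inf_lbound; exists k => //; exists (B @` [set: J]); split=> //.
  by move=> _ [j _ <-]; apply/iterated_joinP; exists (A j); split=> // i; apply: UA.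
apply/seteqP; split=> // v _; have [j jP] := Ac v.
by exists (B j) => //; exists j.
Qed.

(** The infimum runs over natural numbers and is attained: a subcover of size [k] is itself an
    itinerary cover indexed by ['I_k], so the least cardinality of an itinerary cover is a lower
    bound. *)
Lemma min_subcoverE n J : itinerary_cover n J ->
  exists J', itinerary_cover n J' /\
    min_subcover R (iterated_join f U n) = (#|J'|%:R)%:E.
Proof.
move=> Jn; pose P k := `[< exists J', itinerary_cover n J' /\ #|J'| = k >].
have exP : exists k, P k by exists #|J|; apply/asboolP; exists J.
case: (ex_minnP exP) => _ /asboolP[J' [J'n <-]] J'min.
exists J'; split=> //; apply/eqP; rewrite eq_le min_subcover_le//=.
apply: le_ereal_inf_tmp => _ [k [V [VU Vc Vk]] <-].
rewrite lee_fin ler_nat; apply: J'min; apply/asboolP.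
exists 'I_k; rewrite card_ord; split=> //.
have /card_set_bijP[g [gV _ gs]] : (`I_k #= V)%card by rewrite card_eq_sym.
have /choice[A AP] : forall j : 'I_k, exists A : nat -> set T,
    (forall i, (i < n)%N -> U (A i)) /\
    g j = [set v | forall i, (i < n)%N -> A i (iter i f v)].
  by move=> j; apply/iterated_joinP/VU/gV => /=.
exists A; split=> [j|v]; first by have [] := AP j.
have [W VW Wv] : (\bigcup_(W in V) W) v by rewrite Vc.
have [i /= ik giW] := gs _ VW.
exists (Ordinal ik); have [_ gA] := AP (Ordinal ik).
by move: Wv; rewrite -giW (gA : g i = _).
Qed.

Definition subexponential_itineraries : Prop :=
  forall eta : R, 0 < eta -> exists N, forall n, (N <= n)%N ->
  exists J, itinerary_cover n J /\ ln #|J|%:R <= eta * n%:R.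

(** Passage from extended reals to a real sequence: [J1] makes the minimal cardinalities finite, and
    the point [v0] makes them positive, so that logarithms behave. *)
Lemma min_subcover_log (v0 : T) J1 : itinerary_cover 1 J1 ->
  exists h : nat -> R, [/\ forall n, 0 <= h n,
    forall n, lne (min_subcover R (iterated_join f U n)) = (h n)%:E,
    forall n J, itinerary_cover n J -> h n <= ln #|J|%:R &
    forall n, exists J, itinerary_cover n J /\ h n = ln #|J|%:R].
Proof.
move=> J1P.
have card_gt0 n J : itinerary_cover n J -> (0 < #|J|)%N.
  by move=> [A [_ /(_ v0)[j _]]]; apply/card_gt0P; exists j.
have /choice[h hP] : forall n, exists hn : R,
    exists J, [/\ itinerary_cover n J, hn = ln #|J|%:R &
      min_subcover R (iterated_join f U n) = (#|J|%:R)%:E].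
  move=> n; have [J' J'n] := itinerary_cover_exists n J1 J1P.
  by have [J [Jn JE]] := min_subcoverE _ _ J'n; exists (ln #|J|%:R), J.
exists h; split=> n.
- have [J [Jn -> _]] := hP n.
  by rewrite ln_ge0// ler1n (card_gt0 _ _ Jn).
- have [J [Jn -> ->]] := hP n.
  by rewrite lne_EFin// ltr0n (card_gt0 _ _ Jn).
- move=> J Jn; have [J' [J'n -> J'E]] := hP n.
  rewrite ler_ln ?posrE ?ltr0n ?(card_gt0 _ _ Jn) ?(card_gt0 _ _ J'n)//.
  by have := min_subcover_le n J Jn; rewrite J'E lee_fin.
- by have [J [Jn hJ _]] := hP n; exists J.
Qed.

Lemma cover_entropy_lim (v0 : T) J1 : itinerary_cover 1 J1 ->
  exists h : nat -> R, [/\ forall n, 0 <= h n,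
    cvgn (fun n => n%:R^-1 * h n),
    cover_entropy R f U = (limn (fun n => n%:R^-1 * h n))%:E,
    forall n J, itinerary_cover n J -> h n <= ln #|J|%:R &
    forall n, exists J, itinerary_cover n J /\ h n = ln #|J|%:R].
Proof.
move=> J1P; have [h [h0 hE hle hJ]] := min_subcover_log v0 J1 J1P.
have hcvg : cvgn (fun n => n%:R^-1 * h n).
  apply: fekete => // m n.
  have [J [Jm ->]] := hJ m; have [J' [J'n ->]] := hJ n.
  rewrite (le_trans (hle _ _ (itinerary_coverD _ _ _ _ Jm J'n)))//.
  have [j _] : exists j : J, True by have [A [_ /(_ v0)[j _]]] := Jm; exists j.
  have [j' _] : exists j : J', True by have [A [_ /(_ v0)[j' _]]] := J'n; exists j'.
  by rewrite card_prod natrM lnM// posrE ltr0n; apply/card_gt0P; [exists j|exists j'].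
exists h; split=> //; rewrite -EFin_lim//; congr (lim (_ @ \oo)).
by apply/funext => n; rewrite hE -EFinM.
Qed.

Lemma cover_entropy_eq0 (v0 : T) :
  subexponential_itineraries -> cover_entropy R f U = 0%E.
Proof.
move=> Uexp.
have [J1 J1P] : exists J1, itinerary_cover 1 J1.
  have [N NP] := Uexp 1 ltr01.
  (* The length [N.+1] is positive, so this cover can be truncated to length one. *)
  have [J [Jn _]] := NP N.+1 (leqnSn N); exists J.
  by apply: itinerary_coverW Jn.
have [h [h0 hcvg -> hle _]] := cover_entropy_lim v0 J1 J1P.
congr (_%:E); apply/cvg_lim => //; apply/cvgrPdist_le => e e0.
have [N NP] := Uexp e e0; exists N.+1 => // n /= Nn.
have n0 : 0 < n%:R :> R by rewrite ltr0n (leq_trans _ Nn).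
rewrite sub0r normrN ger0_norm ?mulr_ge0 ?invr_ge0 ?(ltW n0)//.
have [J [Jn Jle]] := NP n (ltnW Nn).
by rewrite mulrC ler_pdivrMr// (le_trans (hle _ _ Jn)).
Qed.

Lemma cover_entropy_le0 (v0 : T) J1 : itinerary_cover 1 J1 ->
  (cover_entropy R f U <= 0)%E -> subexponential_itineraries.
Proof.
move=> J1P.
have [h [h0 hcvg -> _ hJ]] := cover_entropy_lim v0 J1 J1P.
rewrite lee_fin => l0 eta eta0.
have [N _ NP] := (cvgrPdist_lt _ _).1 hcvg _ eta0.
exists N.+1 => n Nn; have n0 : 0 < n%:R :> R by rewrite ltr0n (leq_trans _ Nn).
have [J [Jn hnJ]] := hJ n; exists J; split=> //; rewrite -hnJ.
have := NP n (ltnW Nn); rewrite /= distrC => /ltr_normlW.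
rewrite ltrBlDr => hn; rewrite -ler_pdivrMr// mulrC.
by rewrite (le_trans (ltW hn))// gerDl.
Qed.

End Itineraries.

(** * Zero entropy of a compact system read off from one observable *)

Section SymbolicSystem.
Local Open Scope classical_set_scope.
Context (R : realType) (F : numFieldType) (V : normedModType F).
Context (T : topologicalType) (f : T -> T) (e : T -> V) (x : nat -> V).

Lemma open_norm_lt (c : V) (r : F) : open [set z | `|c - z| < r].
Proof. by have := ball_open c r; rewrite -ball_normE. Qed.

Lemma compact_finite_net (A : set V) (r : F) : compact A -> 0 < r ->
  exists (J : finType) (c : J -> V), forall z, A z -> exists j, `|z - c j| < r.
Proof.
rewrite compact_cover => Ac r0.
have [] := Ac V A (fun c => [set z | `|c - z| < r]).
- by move=> c _; exact: open_norm_lt.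
- by move=> z Az; exists z; rewrite //= subrr normr0.
move=> D _ AD; exists D, val => z /AD[c cD /= zc].
by exists [` cD]%fset; rewrite distrC.
Qed.

Hypothesis ef_continuous : forall i, continuous (fun v => e (iter i f v)).
Hypothesis ef_basis : forall v (B : set T), nbhs v B ->
  exists p (r : F), 0 < r /\ forall w,
    (forall i, (i < p)%N -> `|e (iter i f v) - e (iter i f w)| < r) -> B w.
Hypothesis T_compact : compact [set: T].

(** Each point has such a window and tolerance by [ef_basis]; compactness, applied along windows
    tending to infinity and tolerances tending to [0] from the right, makes them uniform. *)
Lemma lebesgue_number (U : set (set T)) : is_open_cover U ->
  exists p (r : F), 0 < r /\ forall v, exists A, U A /\ forall w,
    (forall i, (i < p)%N -> `|e (iter i f v) - e (iter i f w)| < r) -> A w.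
Proof.
move=> [Uo Uc]; pose P (pr : nat * F) v := exists A, U A /\ forall w,
  (forall i, (i < pr.1)%N -> `|e (iter i f v) - e (iter i f w)| < pr.2) -> A w.
have : \forall pr \near filter_prod \oo (0 : F)^'+, [set: T] `<=` P pr.
  apply: (compact_near_coveringP _).1 => // v _.
  have [A UA Av] : (\bigcup_(A in U) A) v by rewrite Uc.
  have [p [r [r0 prA]]] := ef_basis v A (open_nbhs_nbhs (conj (Uo _ UA) Av)).
  have r20 : 0 < r / 2 by rewrite divr_gt0.
  (* Halving [r] lets every [v'] near [v] inherit the set [A] chosen for [v], by the triangle
     inequality. *)
  exists ([set w | forall i : 'I_p, `|e (iter i f v) - e (iter i f w)| < r / 2],
    [set pr : nat * F | (p <= pr.1)%N /\ pr.2 < r / 2]); last first.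
    move=> [v' [p' r']] /= [v'P [pp' r'r]]; exists A; split=> // w wP.
    apply: prA => i ip; rewrite -(subrKA (e (iter i f v'))) (splitr r).
    rewrite (le_lt_trans (ler_normD _ _))// ltrD ?(v'P (Ordinal ip))//.
    by rewrite (lt_trans (wP _ _))// (leq_trans ip).
  split=> /=.
    apply: filter_forall => i.
    have /cvgrPdist_lt := ef_continuous i v.
    exact.
  exists ([set p' | (p <= p')%N], [set r' | r' < r / 2]) => //; split=> /=.
    by exists p.
  exact: nbhs_right_lt.
move=> [[N Q] [[n _ NP] QP] NQ].
have [r [r0 Qr]] : exists r : F, 0 < r /\ Q r.
  have [r []] := filter_ex (filterI QP (nbhs_right_gt (0 : F))).
  by exists r.
exists n, r; split=> // v.
by apply: (NQ (n, r)) => //; split=> //; apply: NP => /=.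
Qed.

Hypothesis x_orbit : forall m, exists v, forall i, e (iter i f v) = x (m + i)%N.
Hypothesis x_dense : forall v n (r : F), 0 < r ->
  exists m, forall i, (i < n)%N -> `|e (iter i f v) - x (m + i)%N| < r.

Lemma orbit_finite_net (r : F) : 0 < r ->
  exists (J : finType) (c : J -> V), forall v, exists j, `|e v - c j| < r.
Proof.
move=> r0; have [|J [c cP]] := @compact_finite_net (e @` [set: T]) r _ r0.
  by apply: continuous_compact => //; apply: continuous_subspaceT (ef_continuous 0).
by exists J, c => v; apply: cP; exists v.
Qed.

Lemma topological_entropy_eq0P :
  topological_entropy R f = 0%E <-> subexponential_blocks R F V x.
Proof.
have [v0 _] := x_orbit 0.
split=> [f0 r eta r0 eta0|xP].
  pose U := [set e @^-1` [set z | `|c - z| < r] | c in [set: V]].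
  have Uo : is_open_cover U.
    split=> [_ [c _ <-]|].
      apply: open_comp => [v _|]; first exact: (ef_continuous 0 v).
      exact: open_norm_lt.
    apply/seteqP; split=> // v _; exists (e @^-1` [set z | `|e v - z| < r]).
      by exists (e v).
    by rewrite /= subrr normr0.
  have [J1 [c1 c1P]] := orbit_finite_net r r0.
  have J1U : itinerary_cover T f U 1 J1.
    exists (fun j _ => e @^-1` [set z | `|c1 j - z| < r]); split.
      by move=> j i _; exists (c1 j).
    by move=> v; have [j jP] := c1P v; exists j => -[|//] _ /=; rewrite distrC.
  have [|N NP] := cover_entropy_le0 T f U R v0 J1 J1U _ eta eta0.
    by rewrite -f0; apply: ereal_sup_ubound; exists U.
  exists N => n /NP[J [[A [UA Ac]] Jn]].
  (* The centres of the balls along an itinerary form the centre of a block; beyond length [n] they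
     default to [0]. *)
  have /choice[c cP] : forall ji : J * nat, exists c, (ji.2 < n)%N ->
      A ji.1 ji.2 = e @^-1` [set z | `|c - z| < r].
    move=> [j i] /=; have [ni|ni] := ltnP i n; last by exists 0.
    by have [c _ <-] := UA j i ni; exists c.
  exists J, (fun j i => c (j, i)); split=> // m.
  have [v vP] := x_orbit m; have [j jP] := Ac v.
  exists j => i ni; rewrite -vP distrC.
  by have := jP i ni; rewrite (cP (j, i) ni).
suff Hle U : is_open_cover U -> cover_entropy R f U = 0%E.
  apply/eqP; rewrite eq_le; apply/andP; split.
    by apply: ge_ereal_sup => _ [U /Hle Uo <-]; rewrite Uo.
  (* The one-set cover, also of entropy [0], bounds the supremum from below. *)
  apply: ereal_sup_ubound; exists [set setT].
    split=> [A ->|]; first exact: openT.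
    by apply/seteqP; split=> // v _; exists setT.
  apply: Hle; split=> [A ->|]; first exact: openT.
  by apply/seteqP; split=> // v _; exists setT.
move=> Uo; apply: cover_entropy_eq0 => // eta eta0.
have [p [r [r0 rP]]] := lebesgue_number U Uo.
(* One quarter of [r] compares a point with a block of [x], another that block with a centre; two
   points near the same centre are then [r]-close. *)
have [r20 r40] : 0 < r / 2 /\ 0 < r / 2 / 2 by rewrite !divr_gt0.
have eta20 : 0 < eta / 2 by rewrite divr_gt0.
have [N NP] := xP _ _ r40 eta20.
(* An [n]-step itinerary is decided by [n + p] coordinates, since each step looks [p] ahead;
   [p <= n] keeps the cost below [eta / 2 * (2 n)]. *)
exists (maxn N p) => n; rewrite geq_max => /andP[Nn pn].
have [J [c [cP Jn]]] := NP (n + p)%N (leq_trans Nn (leq_addr _ _)).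
exists J; split; last first.
  rewrite (le_trans Jn)// [leRHS](_ : _ = eta / 2 * (n%:R + n%:R)); last by lra.
  by rewrite ler_wpM2l ?(ltW eta20)// -natrD ler_nat leq_add2l.
have [A0 [UA0 _]] := rP v0.
have /choice[A AP] : forall j, exists A : nat -> set T, (forall i, U (A i)) /\
    forall v, (forall i, (i < n + p)%N -> `|e (iter i f v) - c j i| < r / 2) ->
    forall i, (i < n)%N -> A i (iter i f v).
  (* A centre with a nearby point takes the itinerary of that point; one without any gets the
     default [A0]. *)
  move=> j; have [[v vP]|nv] := pselect (exists v,
      forall i, (i < n + p)%N -> `|e (iter i f v) - c j i| < r / 2); last first.
    by exists (fun=> A0); split=> // v vP; exfalso; apply: nv; exists v.
  have /choice[A AP] : forall i, exists A, U A /\ forall w, (forall k, (k < p)%N ->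
      `|e (iter k f (iter i f v)) - e (iter k f w)| < r) -> A w.
    by move=> i; apply: rP.
  exists A; split=> [i|w wP i ni]; first by have [] := AP i.
  have [_] := AP i; apply=> k kp; rewrite -!iterD.
  have ki : (k + i < n + p)%N by rewrite addnC -addnS leq_add// ltnW.
  rewrite -(subrKA (c j (k + i)%N)) (splitr r) (le_lt_trans (ler_normD _ _))//.
  by rewrite ltrD ?vP// distrC wP.
exists A; split=> [j i _|v]; first by have [] := AP j.
have [m mP] := x_dense v (n + p) _ r40; have [j jP] := cP m.
exists j; have [_] := AP j; apply=> i ni.
rewrite -(subrKA (x (m + i)%N)) (splitr (r / 2)) (le_lt_trans (ler_normD _ _))//.
by rewrite ltrD ?mP ?jP.
Qed.

End SymbolicSystem.

(** * The orbit closure as such a system, observed at coordinate zero *)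

Section OrbitClosure.
Local Open Scope classical_set_scope.

Lemma cvg_initial_topology (S : choiceType) (T : topologicalType) (g : S -> T)
    (G : set_system S) (s : S) : Filter G ->
  g @ G --> g s -> G --> (s : initial_topology g).
Proof.
move=> FG gs A [_ [[B oB <-] Bs] BA].
by apply: filterS BA _; apply: gs; apply: open_nbhs_nbhs.
Qed.

Lemma compact_set_type (T : topologicalType) (A : set T) :
  compact A -> compact [set: A].
Proof.
move=> Ac G PG _.
have GA : (set_val @ G) A by apply: (@filterS _ G _ setT) => [u _|]; [exact: set_valP | exact: filterT].
have [z [Az zG]] := Ac (set_val @ G) _ GA.
exists (SigSub (mem_set Az)); split=> // B C GB [_ [[D oD <-] Dz] DC].
have GB' : (set_val @ G) (set_val @` B) by apply: (@filterS _ G _ B) => // u Bu; exists u.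
have [_ [[u Bu <-] Du]] := zG _ D GB' (open_nbhs_nbhs (conj oD Dz)).
by exists u; split=> //; apply: DC.
Qed.

Context (F : numFieldType) (V : normedModType F) (x : nat -> V).
Hypothesis x_precompact : compact (closure (range x)).

Let X := orbit_closure (closure_seq x).

(** The inner [set_val] leaves the orbit closure, the outer one the closure of the range of [x]. *)
Definition orbit_coord (v : X) (i : nat) : V := set_val (set_val v i).

Lemma iter_orbit_shift i (v : X) n :
  orbit_coord (iter i (orbit_shift (w := closure_seq x)) v) n =
  orbit_coord v (i + n)%N.
Proof. by elim: i n => [|i IH] n //=; rewrite addSnnS -IH. Qed.

Lemma orbit_coord_continuous i : continuous (fun v : X => orbit_coord v i).
Proof.
move=> v; apply: (@continuous_comp _ _ _ (fun v : X => set_val v i) set_val).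
  apply: (@continuous_comp _ _ _ (set_val : X -> _) (fun w => w i)).
    exact: initial_continuous.
  exact: proj_continuous.
exact: initial_continuous.
Qed.

Lemma orbit_coord_basis (v : X) (B : set X) : nbhs v B ->
  exists p (r : F), 0 < r /\ forall w,
    (forall i, (i < p)%N -> `|orbit_coord v i - orbit_coord w i| < r) -> B w.
Proof.
pose C (pr : nat * F) :=
  [set w | forall i, (i < pr.1)%N -> `|orbit_coord v i - orbit_coord w i| < pr.2].
pose G := filter_from [set pr : nat * F | 0 < pr.2] C.
have FG : Filter G.
  apply: filter_from_filter; first by exists (0%N, 1) => /=.
  move=> [p r] [p' r'] /= r0 r'0.
  have [r'' [[r''r r''r'] r''0]] := filter_ex (filterI (filterI
    (nbhs_right_lt r0) (nbhs_right_lt r'0)) (nbhs_right_gt (0 : F))).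
  exists (maxn p p', r'') => // w wP; split=> i ip /=.
    by rewrite (lt_trans (wP _ _))//= leq_max ip.
  by rewrite (lt_trans (wP _ _))//= leq_max ip orbT.
(* Convergence of the filter of coordinate boxes is checked one layer at a time: orbit closure,
   product, then closure of the range. *)
suff Gv : G --> v by move=> /Gv[[p r] r0 prB]; exists p, r; split.
apply: cvg_initial_topology; apply/cvg_sup => i.
apply: cvg_initial_topology; apply: cvg_initial_topology.
apply/cvgrPdist_lt => r r0; exists (i.+1, r) => // w; exact.
Qed.

Lemma orbit_closure_compact : compact [set: X].
Proof.
apply: compact_set_type; apply: (@subclosed_compact _ _ setT).
- exact: closed_closure.
- have := @tychonoff nat (fun=> closure (range x)) (fun=> setT).
  move=> /(_ (fun=> compact_set_type _ _ x_precompact)).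
  by congr compact; apply/seteqP; split.
- by [].
Qed.

Lemma orbit_coord_tail m : exists v : X, forall i, orbit_coord v i = x (m + i)%N.
Proof.
have tailX : X (seq_tail (closure_seq x) m) by apply: subset_closure; exists m.
by exists (SigSub (mem_set tailX)).
Qed.

Lemma orbit_coord_dense (v : X) n (r : F) : 0 < r ->
  exists m, forall i, (i < n)%N -> `|orbit_coord v i - x (m + i)%N| < r.
Proof.
move=> r0.
pose Y : topologicalType := {ptws nat -> closure (range x)}.
pose B (i : 'I_n) (w : Y) := `|orbit_coord v i - set_val (w i)| < r.
have vB : \forall w \near (set_val v : Y), forall i, B i w.
  apply: (@filter_forall Y 'I_n B _ (nbhs_filter (set_val v : Y))) => i.
  have wc : continuous (fun w : Y => set_val (w i) : V).
    move=> w; apply: (@continuous_comp _ _ _ (fun w : Y => w i) set_val).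
      exact: proj_continuous.
    exact: initial_continuous.
  by have /cvgrPdist_lt := wc (set_val v); apply.
have [_ [[m _ <-] mB]] := set_valP v _ vB.
by exists m => i ni; apply: (mB (Ordinal ni)).
Qed.

Lemma anqie_entropy_eq0P (R : realType) :
  anqie_entropy R x = 0%E <-> subexponential_blocks R F V x.
Proof.
pose e (v : X) := orbit_coord v 0.
have eE i v : e (iter i (orbit_shift (w := closure_seq x)) v) = orbit_coord v i.
  by rewrite /e iter_orbit_shift addn0.
have eE' i : (fun v => e (iter i (orbit_shift (w := closure_seq x)) v)) =
    orbit_coord^~ i by apply/funext => v; rewrite eE.
apply: (topological_entropy_eq0P _ _ _ _ _ e) => [i|v B /orbit_coord_basis|||].
- by rewrite eE'; apply: orbit_coord_continuous.
- move=> [p [r [r0 prB]]]; exists p, r; split=> // w wP.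
  by apply: prB => i ip; have := wP i ip; rewrite !eE.
- exact: orbit_closure_compact.
- by move=> m; have [v vm] := orbit_coord_tail m; exists v => i; rewrite eE.
- move=> v n r /(orbit_coord_dense v n)[m mP]; exists m => i ni.
  by rewrite eE mP.
Qed.
Lemma block_net_precompact (r : F) : 0 < r ->
  exists (J : finType) (c : J -> nat -> V), block_net F V x r 1 J c.
Proof.
move=> r0; have [J [c cP]] := compact_finite_net F V _ r x_precompact r0.
exists J, (fun j _ => c j) => m.
have [|j jP] := cP (x m); first by apply: subset_closure; exists m.
by exists j => -[|//] _; rewrite addn0.
Qed.

End OrbitClosure.

(** * Bounded complex sequences have precompact range *)

Section ComplexPlane.
Local Open Scope classical_set_scope.
Context (R : realType).

Lemma real_complex_continuous : continuous (fun a : R => a%:C : R[i]^o).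
Proof.
(* In the order of [R[i]], a positive [e] has zero imaginary part, so its real part serves as the
   real tolerance. *)
move=> a; apply/cvgrPdist_lt => e; rewrite ltcE /= => /andP[/eqP Ime Re0].
have /cvgrPdist_lt/(_ _ Re0) : (b @[b --> a] --> a) by exact: cvg_id.
apply: filterS => b ab.
rewrite -rmorphB /= normc_def /= expr0n addr0 sqrtr_sqr ltcE /= Ime eqxx.
exact: ab.
Qed.

Lemma bounded_complex_precompact (x : nat -> R[i]^o) (M : R) :
  (forall n, `|x n| <= M%:C) -> compact (closure (range x)).
Proof.
move=> xM.
pose g (ab : R * R) : R[i]^o := (ab.1%:C : R[i]^o) + 'i *: (ab.2%:C : R[i]^o).
have g_cont : continuous g.
  move=> ab; apply: cvgD.
    apply: (@continuous_comp _ _ _ fst); last exact: real_complex_continuous.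
    exact: cvg_fst.
  apply: cvgZl_tmp; apply: (@continuous_comp _ _ _ snd); last exact: real_complex_continuous.
  exact: cvg_snd.
(* The range lies in this image of a square, which is compact and, the plane being Hausdorff,
   closed. *)
have gc : compact (g @` (`[-M, M] `*` `[-M, M])).
  apply: continuous_compact; first exact: continuous_subspaceT.
  by apply: compact_setX; apply: segment_compact.
apply: (subclosed_compact _ gc); first exact: closed_closure.
rewrite closureE; apply: smallest_sub.
  by apply: compact_closed gc; exact: norm_hausdorff.
move=> _ [n _ <-]; exists (complex.Re (x n), complex.Im (x n)).
  split; rewrite /= in_itv /= -ler_norml -lecR (le_trans _ (xM n))//.
    exact: normc_ge_Re.
  have normi : `|'i%C : R[i]| = 1 by rewrite normc_def /= expr0n expr1n add0r sqrtr1.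
  (* Up to sign the imaginary part is the real part after multiplication by ['i], which preserves
     the norm. *)
  by rewrite -normrN -ReiNIm (le_trans (normc_ge_Re _))// normrM normi mulr1.
by rewrite /g /= [RHS]complexE complexiE.
Qed.
End ComplexPlane.

(* R[i]^o is the field R[i] carrying the topology of its norm. *)
Theorem corollary1p2 (R : realType) (x : nat -> R[i]^o)
    (hx : exists M : R, forall n : nat, `|x n| <= M%:C) :
  anqie_entropy (K := R[i]^o) R (fun n : nat => x n.+1 - x n) = 0%E <->
  anqie_entropy (K := R[i]^o) R x = 0%E.
Proof.
have [M xM] := hx.
have x_pre := bounded_complex_precompact R x M xM.
have d_pre : compact (closure (range (fun n => x n.+1 - x n)))%classic.
  apply: (bounded_complex_precompact R _ (M + M)) => n.
  by rewrite rmorphD/= (le_trans (ler_normB _ _))// lerD.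
split.
- move=> /(anqie_entropy_eq0P _ _ _ d_pre) dP.
  apply/(anqie_entropy_eq0P _ _ _ x_pre).
  apply: subexponential_blocks_of_diff => // e e0.
  exact: block_net_precompact.
- move=> /(anqie_entropy_eq0P _ _ _ x_pre) xP.
  apply/(anqie_entropy_eq0P _ _ _ d_pre).
  exact: subexponential_blocks_diff.
Qed.
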